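(* Let $T\ge1$ and let $(\sigma_x,\ell)$ be a random pair of positive numbers (drawn from a mixing distribution). Suppose that, conditionally on $(\sigma_x,\ell)$, the attributes are i.i.d. $\mathcal{N}(0,\sigma_x^2I)$ in $\mathbb{R}^T$ and are independent of a utility $\mathcal{U}$ on $\mathbb{R}^T\times\mathbb{R}^T$ whose covariance is the stationary isotropic squared exponential kernel $$k_u([x,y],[v,w])=\sigma_u^2\exp\left(-\frac{\|x-v\|_2^2+\|y-w\|_2^2}{2\ell^2}\right)$$ with fixed $\sigma_u>0$, and that $\mathcal{F}(x,y)=\mathcal{U}(x,y)-\mathcal{U}(y,x)$ has mean zero. Let $\pi_r$ be the distribution of the roughness coefficient $r=\sigma_x/\ell$. Then the shared-endpoint correlation is $$\rho=\frac{\mathbb{E}_{r\sim\pi_r}\left[(1+2r^2)^{-T/2}\right]-\mathbb{E}_{r\sim\pi_r}\left[(1+r^2)^{-T/2}(1+3r^2)^{-T/2}\right]}{1-\mathbb{E}_{r\sim\pi_r}\left[(1+4r^2)^{-T/2}\right]}.$$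
   Context: Let $X,Y,W$ be the attributes of three distinct vertices. The variance and shared-endpoint correlation of the random skew-symmetric function $\mathcal{F}$ are, with all averages taken also over the mixing distribution of $(\sigma_x,\ell)$, $$\sigma^2=\mathbb{E}\left[\mathrm{Var}_{X,Y}(\mathcal{F}(X,Y)\mid\mathcal{F},\sigma_x,\ell)\right],\qquad \rho=\frac{1}{\sigma^2}\,\mathbb{E}\left[\mathrm{Cov}_{X,Y,W}(\mathcal{F}(X,Y),\mathcal{F}(X,W)\mid\mathcal{F},\sigma_x,\ell)\right].$$ When $\sigma_x$ is deterministic this is the case of isotropic Gaussian attributes and a utility kernel that is an isotropic scale mixture of squared exponential kernels. *)

(* Defs.v *)
From HB Require Import structures.
From mathcomp Require Import all_boot all_order all_algebra.
From mathcomp Require Import all_classical all_reals all_analysis.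
From mathcomp Require Import measurable_realfun.

Set Implicit Arguments.
Unset Strict Implicit.
Unset Printing Implicit Defensive.

Import Order.TTheory GRing.Theory Num.Theory.
Import numFieldNormedType.Exports.

Local Open Scope classical_set_scope.
Local Open Scope ring_scope.

(* Vectors of R^T are T-tuples, which carry the product sigma-algebra. *)

Section isotropic_gaussian.
Context {R : realType}.

Definition cons_coord n (p : measurableTypeR R * n.-tuple R) : n.+1.-tuple R :=
  [the n.+1.-tuple R of p.1 :: p.2].

Lemma measurable_cons_coord n : measurable_fun setT (@cons_coord n).
Proof.
by apply: (@measurable_cons _ _ (measurableTypeR R * n.-tuple R)%type _ fst n snd).
Qed.

HB.instance Definition _ n :=
  isMeasurableFun.Build _ _ _ _ (@cons_coord n) (@measurable_cons_coord n).

(* n-fold product of a probability on the line, built one coordinate at a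
   time *)
Fixpoint iid_prob (N : probability (measurableTypeR R) R) (n : nat) :
    probability (n.-tuple R) R :=
  match n with
  | 0 => dirac [tuple]
  | n'.+1 => distribution (N \x iid_prob N n')%E (@cons_coord n')
  end.

(* N(0, s^2 I) on R^T; the second argument of normal_prob is the standard
   deviation. *)
Definition isotropic_gaussian (T : nat) (s : R) : probability (T.-tuple R) R :=
  iid_prob (normal_prob 0 s) T.

End isotropic_gaussian.

Section squared_exponential.
Context {R : realType} {T : nat}.

Definition sqdist (x y : T.-tuple R) : R :=
  \sum_(i < T) (tnth x i - tnth y i) ^+ 2.

Definition se_kernel (su l : R) (p q : T.-tuple R * T.-tuple R) : R :=
  su ^+ 2 * expR (- ((sqdist p.1 q.1 + sqdist p.2 q.2) / (2 * l ^+ 2))).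

Definition skew_part (U : T.-tuple R * T.-tuple R -> R) (x y : T.-tuple R) : R :=
  U (x, y) - U (y, x).

End squared_exponential.

Section conditioning.
Context {d} {Omega : measurableType d} {R : realType}.
Variable P : probability Omega R.

(* k is a regular conditional law of Z given V *)
Definition is_cond_law {d1 d2} {E1 : measurableType d1} {E2 : measurableType d2}
    (V : Omega -> E1) (Z : Omega -> E2) (k : E1 -> probability E2 R) : Prop :=
  (forall B, measurable B -> measurable_fun setT (k ^~ B)) /\
  (forall D B, measurable D -> measurable B ->
    P (V @^-1` D `&` Z @^-1` B) = (\int[P]_(w in V @^-1` D) k (V w) B)%E).

(* Z' is a version of E[Z | G], where G is a sub-sigma-algebra given by its
   events *)
Definition is_cond_exp (G : set (set Omega)) (Z Z' : Omega -> R) : Prop :=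
  [/\ P.-integrable setT (EFin \o Z),
      P.-integrable setT (EFin \o Z'),
      (forall B : set R, measurable B -> G (Z' @^-1` B)) &
      (forall A, G A -> (\int[P]_(w in A) (Z w)%:E = \int[P]_(w in A) (Z' w)%:E)%E)].

(* A version of E[Z | G]; the default value 0 is only used when no version
   exists, i.e. when Z is not integrable. *)
Definition cond_exp (G : set (set Omega)) (Z : Omega -> R) : Omega -> R :=
  xget (cst 0) [set Z' | is_cond_exp G Z Z'].

Definition cond_cov (G : set (set Omega)) (Z1 Z2 : Omega -> R) : Omega -> R :=
  cond_exp G ((Z1 \- cond_exp G Z1) \* (Z2 \- cond_exp G Z2)).

Definition cond_var (G : set (set Omega)) (Z : Omega -> R) : Omega -> R :=
  cond_cov G Z Z.

(* sigma(F, s, l): a random function generates the sigma-algebra of all its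
   evaluations *)
Definition sigma_field_scale {I : Type} (F : Omega -> I -> R)
    (s l : Omega -> R) : set (set Omega) :=
  <<s \bigcup_(i in [set: I]) preimage_set_system setT (F ^~ i) measurable `|`
      preimage_set_system setT s measurable `|`
      preimage_set_system setT l measurable >>.

End conditioning.

Section shared_endpoint.
Context {d} {Omega : measurableType d} {R : realType} {T : nat}.
Variable P : probability Omega R.
Variable F : Omega -> T.-tuple R -> T.-tuple R -> R.
Variables s l : Omega -> R.
Variables X Y W : Omega -> T.-tuple R.

Let G := sigma_field_scale (fun w p => F w p.1 p.2) s l.
Let FXY w := F w (X w) (Y w).
Let FXW w := F w (X w) (W w).

(* E[Var_{X,Y}(F(X,Y) | F, s, l)]; versions of conditional expectations are
   integrable by definition, so fine only drops the EFin wrapper. *)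
Definition skew_variance : R := fine 'E_P[cond_var P G FXY].

Definition shared_endpoint_corr : R :=
  skew_variance^-1 * fine 'E_P[cond_cov P G FXY FXW].

End shared_endpoint.

Section roughness.
Context {d} {Omega : measurableType d} {R : realType}.
Variables s l : {mfun Omega >-> R}.

Definition roughness (w : Omega) : R := s w / l w.

Lemma measurable_roughness : measurable_fun setT roughness.
Proof.
have -> : roughness = fun w => s w * (l w * (l w ^+ 2) `^ (-1)).
  apply/funext => w; rewrite /roughness powR_inv1 ?sqr_ge0//.
  have [->|l0] := eqVneq (l w) 0; first by rewrite invr0 mul0r.
  by congr (_ * _); rewrite expr2 invfM mulrA divff ?mul1r.
apply: measurable_funM => //; apply: measurable_funM => //.
apply: (measurableT_comp (measurable_powR (-1))).
exact: measurable_funX.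
Qed.

HB.instance Definition _ :=
  isMeasurableFun.Build _ _ _ _ roughness measurable_roughness.

End roughness.

(* Main.v *)
(* Given the attributes' scale and the utility, swapping X with Y preserves the
   joint law and every event of sigma(F, s, l) but negates F(X,Y), so
   E[F(X,Y) | F, s, l] = 0: the averaged conditional variance and covariance
   are E[F(X,Y)^2] and E[F(X,Y) F(X,W)].  Averaging over the utility first, the
   kernel gives
     E[F(x,y) F(x,w)] = 2 su^2 (e(y,w) - e(x,y) e(x,w)),
     e(x,y) = exp(- |x - y|^2 / (2 l^2)),
   and the Gaussian attributes then integrate these exponentials, one vector at
   a time, by completing the square. *)

Require Import Defs.
From HB Require Import structures.
From mathcomp Require Import all_boot all_order all_algebra.
From mathcomp Require Import all_classical all_reals all_analysis.
From mathcomp Require Import measurable_realfun.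
From mathcomp Require Import ring lra.

Set Implicit Arguments.
Unset Strict Implicit.
Unset Printing Implicit Defensive.

Import Order.TTheory GRing.Theory Num.Theory.
Import numFieldNormedType.Exports.

Local Open Scope classical_set_scope.
Local Open Scope ring_scope.

(** * Conditional expectation *)

(** Integrability dictates the shape of the argument. [cond_exp] is picked by [xget], so it is
    meaningful only once a version exists, and removing the conditioning requires F(X,Y), F(X,W) and
    their products to be integrable. The squares come first: being nonnegative, they can be
    integrated against the conditional law without any prior bound, and the kernel makes the result
    finite. The products are then integrable by domination, which in turn allows the signed F(X,Y)
    F(X,W) to be integrated against the conditional law. The conditional mean is shown to vanish on
    the sigma-field generated by [(sigx, ell)] and [u], which contains sigma(F, s, l). It is the
    preimage system of a single map that does not mention the attributes, so exchanging them visibly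
    fixes its events. *)

Section conditional_expectation.
Context {d} {Omega : measurableType d} {R : realType}.
Variable P : probability Omega R.
Variable C : set (set Omega).
Hypothesis mC : C `<=` measurable.

Let mG (A : set Omega) : <<s C >> A -> measurable A.
Proof. by apply: smallest_sub => //; exact: sigma_algebra_measurable. Qed.

(** Existence of a version by Radon-Nikodym: on the sub-sigma-algebra, the charge sending A to the
    integral of [Z] over A is dominated by [P], and its density is the version sought. *)
Lemma cond_exp_spec (Z : Omega -> R) : P.-integrable setT (EFin \o Z) ->
  is_cond_exp P <<s C >> Z (cond_exp P <<s C >> Z).
Proof.
move=> iZ; suff [Z' HZ'] : exists Z', is_cond_exp P <<s C >> Z Z'.
  exact: xgetPex (ex_intro _ Z' HZ').
pose G := g_sigma_algebraType C.
(* The identity into the coarser space [G] is measurable; pushing a measure forward along it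
   restricts that measure to [<<s C >>]. *)
have midG : measurable_fun [set: Omega] (id : Omega -> G).
  by move=> _ B mB; rewrite setTI; exact: mG.
pose idG : {mfun Omega >-> G} := HB.pack (id : Omega -> G)
  (isMeasurableFun.Build _ _ _ _ (id : Omega -> G) midG).
pose PG : probability G R := distribution P idG.
(* The canonical instance is named because the measurability of the map is an
   argument that unification cannot find. *)
pose nu : {charge set G -> \bar R} :=
  measure_function_pushforward__canonical__charge_Charge (induced_charge iZ) midG.
have nuPG : nu `<< PG.
  apply/null_content_dominatesP => A mA PA0.
  rewrite /= /pushforward /= /induced_charge.
  apply: null_set_integral => //; first exact: mG.
  by apply: measurable_funTS; exact: measurable_int iZ.
pose RN := Radon_Nikodym nu PG.
have iRN : PG.-integrable setT RN := Radon_Nikodym_integrable nuPG.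
have mRN : measurable_fun [set: G] RN := measurable_int _ iRN.
have RNfin x : (fine (RN x))%:E = RN x.
  by rewrite fineK//; exact: Radon_Nikodym_fin_num.
have iRN' : P.-integrable setT (RN \o idG).
  apply/integrableP; split; first exact: measurableT_comp.
  move/integrableP : iRN => [_]; rewrite ge0_integral_pushforward//.
  exact: measurableT_comp.
exists (fine \o RN).
have E : EFin \o (fine \o RN) = RN \o idG by apply/funext => x; exact: RNfin.
split => //; first by rewrite E.
- move=> B mB.
  have : measurable_fun [set: G] (fine \o RN) by exact: measurableT_comp.
  by move=> /(_ measurableT B mB); rewrite setTI.
- move=> A GA.
  transitivity (nu A) => //.
  rewrite (Radon_Nikodym_integral nuPG)//.
  rewrite integral_pushforward//.
    by apply: eq_integral => x _; exact/esym/RNfin.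
  exact: (integrableS measurableT (mG GA) (@subsetT _ _) iRN').
Qed.

(** The sets where the version is nonnegative or negative are themselves conditioning events. Its
    integral vanishes on both, hence so does the integral of its absolute value. *)
Lemma cond_exp_eq0 (Z : Omega -> R) : P.-integrable setT (EFin \o Z) ->
  (forall A, <<s C >> A -> \int[P]_(w in A) (Z w)%:E = 0)%E ->
  ae_eq P setT (cond_exp P <<s C >> Z) (cst 0).
Proof.
move=> iZ Z0; have [_ iZ' GZ' ZZ'] := cond_exp_spec iZ.
set Z' := cond_exp _ _ _ in iZ' GZ' ZZ' *.
have mZ' : measurable_fun setT Z' by apply/measurable_EFinP; exact: measurable_int iZ'.
have half (B : set R) : measurable B ->
    (\int[P]_(w in Z' @^-1` B) (Z' w)%:E = 0)%E.
  by move=> mB; rewrite -ZZ' ?Z0//; exact: GZ'.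
have mZB (B : set R) : measurable B -> measurable (Z' @^-1` B).
  by move=> mB; apply: mG; exact: GZ'.
suff : ae_eq P setT (EFin \o Z') (cst 0%E).
  by apply: filterS => w /= /(_ I) [].
apply/(ae_eq_integral_abs P measurableT); first exact: measurable_int iZ'.
pose B := `[0, +oo[%classic : set R.
have mB : measurable B by exact: measurable_itv.
rewrite -(setUv (Z' @^-1` B)) ge0_integral_setU//=; last 4 first.
- exact: mZB.
- by rewrite preimage_setC; apply: mZB; exact: measurableC.
- by rewrite setUv; apply/measurable_EFinP; exact: measurableT_comp.
- by apply/disj_setPCl.
rewrite [X in (X + _)%E](_ : _ = 0%E); last first.
  rewrite -[RHS](half B)//; apply: eq_integral => w.
  by rewrite inE /B /= in_itv/= andbT => w0; rewrite ger0_norm.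
rewrite add0e preimage_setC.
apply: oppe_inj; rewrite oppe0 -integral_ge0N//.
rewrite -[RHS](half (~` B)); last exact: measurableC.
apply: eq_integral => w; rewrite inE /B /= in_itv/= andbT => /negP.
by rewrite -ltNge => w0; rewrite ltr0_norm// opprK.
Qed.

(** Both conditional means vanish almost surely, so centring changes the product only on a null set.
    Testing the outer conditional expectation on the whole space then removes the conditioning. *)
Lemma expectation_cond_cov (Z1 Z2 : Omega -> R) :
    P.-integrable setT (EFin \o Z1) -> P.-integrable setT (EFin \o Z2) ->
    P.-integrable setT (EFin \o (Z1 \* Z2)) ->
    (forall A, <<s C >> A -> \int[P]_(w in A) (Z1 w)%:E = 0)%E ->
    (forall A, <<s C >> A -> \int[P]_(w in A) (Z2 w)%:E = 0)%E ->
  ('E_P[cond_cov P <<s C >> Z1 Z2] = 'E_P[Z1 \* Z2])%E.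
Proof.
move=> i1 i2 i12 z1 z2.
have c1 := cond_exp_eq0 i1 z1; have c2 := cond_exp_eq0 i2 z2.
have [_ ic1 _ _] := cond_exp_spec i1; have [_ ic2 _ _] := cond_exp_spec i2.
set Z := ((Z1 \- cond_exp P <<s C >> Z1) \* (Z2 \- cond_exp P <<s C >> Z2)).
have mZ : measurable_fun setT Z.
  by apply: measurable_funM; apply: measurable_funB; apply/measurable_EFinP;
    [exact: measurable_int i1|exact: measurable_int ic1
    |exact: measurable_int i2|exact: measurable_int ic2].
have ZE : ae_eq P setT (EFin \o Z) (EFin \o (Z1 \* Z2)).
  apply: filterS2 c1 c2 => w /= /(_ I) e1 /(_ I) e2 _.
  by rewrite /Z /= e1 e2 !subr0.
have iZ : P.-integrable setT (EFin \o Z).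
  apply/integrableP; split; first exact/measurable_EFinP.
  have [m12 +] := integrableP _ _ _ i12.
  suff -> : (\int[P]_x `|(EFin \o Z) x| = \int[P]_x `|(EFin \o (Z1 \* Z2)%R) x|)%E by [].
  apply: ae_eq_integral => //; [exact/measurable_EFinP/measurableT_comp
    |exact: measurableT_comp|].
  by apply: filterS ZE => w + _ => /(_ I) ->.
have [_ _ _ /(_ setT)] := cond_exp_spec iZ.
rewrite /cond_cov -/Z unlock => <-; last exact: (@measurableT _ (g_sigma_algebraType C)).
apply: ae_eq_integral => //; [exact: measurable_int iZ|exact: measurable_int i12].
Qed.
End conditional_expectation.

(** * Integration against a conditional law *)

Section cond_law_integral.
Context {d d1 d2} {Omega : measurableType d} {E1 : measurableType d1}
  {E2 : measurableType d2} {R : realType} (P : probability Omega R).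
Variables (V : Omega -> E1) (Z : Omega -> E2) (k : E1 -> probability E2 R).
Hypotheses (mV : measurable_fun setT V) (mZ : measurable_fun setT Z).
Hypothesis VZk : is_cond_law P V Z k.

(** The defining identity with [D = setT] says that the law of [Z] is the composition of [P] with
    the Markov kernel [k \o V]; integrating against a composition of kernels gives the iterated
    integral. *)
Lemma cond_law_integral (f : E2 -> \bar R) : measurable_fun setT f ->
    (forall z, 0 <= f z)%E ->
  (\int[P]_w f (Z w) = \int[P]_w \int[k (V w)]_z f z)%E.
Proof.
move=> mf f0; have [mk kP] := VZk.
(* In [kcomp] the second kernel also sees the source of the first one; that source is [unit] here,
   since [P] is viewed as a kernel from a point. *)
pose kV (p : unit * Omega) : {measure set E2 -> \bar R} := k (V p.2).
have mkV U : measurable U -> measurable_fun [set: unit * Omega] (kV ^~ U).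
  move=> mU; apply: (measurableT_comp (mk _ mU)).
  exact: measurableT_comp.
have kV1 x : kV x setT = 1%E by exact: probability_setT.
pose K := HB.pack_for (R.-ker (unit * Omega) ~> E2) kV
  (isKernel.Build _ _ _ _ _ kV mkV).
pose K1 : R.-pker (unit * Omega) ~> E2 := HB.pack (K : _ -> _) K
  (Kernel_isProbability.Build _ _ _ _ _ (K : _ -> _) kV1).
pose l : R.-pker unit ~> Omega := kprobability
  (@measurable_cst _ _ _ _ setT (P : pprobability Omega R)).
transitivity (\int[kcomp l K1 tt]_z f z)%E; last exact: integral_kcomp.
rewrite -[LHS](ge0_integral_pushforward mZ P measurableT)//.
apply: eq_measure_integral => A mA _.
by have := kP setT A measurableT mA; rewrite preimage_setT setTI.
Qed.

Lemma cond_law_comp {d3} {E3 : measurableType d3} (g : E2 -> E3)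
    (k' : E1 -> probability E3 R) : measurable_fun setT g ->
    (forall t B, measurable B -> k' t B = k t (g @^-1` B)) ->
  is_cond_law P V (g \o Z) k'.
Proof.
move=> mg kk'; have [mk kP] := VZk.
have mgB B : measurable B -> measurable (g @^-1` B).
  by move=> mB; rewrite -[X in measurable X]setTI; exact: mg.
split=> [B mB|D B mD mB].
  by under eq_fun do rewrite kk'//; exact: mk (mgB _ mB).
rewrite (kP _ _ mD (mgB _ mB)).
by apply: eq_integral => w _; rewrite kk'.
Qed.

(** The conditional law fixes the joint probabilities of rectangles, which form a generating
    pi-system of the product sigma-algebra. *)
Lemma cond_law_joint (Z' : Omega -> E2) : measurable_fun setT Z' ->
    is_cond_law P V Z' k ->
  forall D : set (E1 * E2), measurable D ->
    P ((fun w => (V w, Z w)) @^-1` D) = P ((fun w => (V w, Z' w)) @^-1` D).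
Proof.
move=> mZ' VZ'k D mD.
have mVZ : measurable_fun setT (fun w => (V w, Z w)) by exact: measurable_fun_pair.
have mVZ' : measurable_fun setT (fun w => (V w, Z' w)) by exact: measurable_fun_pair.
pose m : {measure set (E1 * E2) -> \bar R} :=
  measure_function_pushforward__canonical__measure_function_Measure P mVZ.
pose m' : {measure set (E1 * E2) -> \bar R} :=
  measure_function_pushforward__canonical__measure_function_Measure P mVZ'.
apply: (@measure_unique _ R (E1 * E2)%type
  [set A `*` B | A in measurable & B in measurable] (fun=> setT) _ _ _ _ m m') => //.
- exact: measurable_prod_measurableType.
- move=> _ _ [A mA [B mB <-]] [A' mA' [B' mB' <-]].
  rewrite -setXI; exists (A `&` A'); first exact: measurableI.
  by exists (B `&` B') => //; exact: measurableI.
- by move=> _; exists setT => //; exists setT => //; rewrite setXTT.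
- by rewrite bigcup_const.
- move=> _ [A mA [B mB <-]].
  transitivity (P (V @^-1` A `&` Z @^-1` B)) => //.
  by rewrite VZk.2// -VZ'k.2.
- by move=> _; rewrite /= /pushforward preimage_setT probability_setT ltry.
Qed.

Lemma cond_law_joint_integral (Z' : Omega -> E2) (f : E1 * E2 -> \bar R) D :
    measurable_fun setT Z' -> is_cond_law P V Z' k ->
    measurable D -> measurable_fun setT f ->
    P.-integrable setT (fun w => f (V w, Z w)) ->
    P.-integrable setT (fun w => f (V w, Z' w)) ->
  (\int[P]_(w in (fun w => (V w, Z w)) @^-1` D) f (V w, Z w) =
   \int[P]_(w in (fun w => (V w, Z' w)) @^-1` D) f (V w, Z' w))%E.
Proof.
move=> mZ' VZ'k mD mf fZ fZ'.
have mVZ : measurable_fun setT (fun w => (V w, Z w)) by exact: measurable_fun_pair.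
have mVZ' : measurable_fun setT (fun w => (V w, Z' w)) by exact: measurable_fun_pair.
have pre (h : Omega -> E1 * E2) : measurable_fun setT h -> measurable (h @^-1` D).
  by move=> mh; rewrite -[X in measurable X]setTI; exact: mh.
rewrite -[LHS](integral_pushforward (mu := P) mVZ mf)//; last first.
  exact: (integrableS measurableT (pre _ mVZ) (@subsetT _ _) fZ).
rewrite -[RHS](integral_pushforward (mu := P) mVZ' mf)//; last first.
  exact: (integrableS measurableT (pre _ mVZ') (@subsetT _ _) fZ').
by apply: eq_measure_integral => A mA _; exact: cond_law_joint.
Qed.
End cond_law_integral.

Lemma measurable_cond_law_integral {d d1 d2} {Omega : measurableType d}
    {E1 : measurableType d1} {E2 : measurableType d2} {R : realType}
    (P : probability Omega R) (V : Omega -> E1) (Z : Omega -> E2)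
    (k : E1 -> probability E2 R) (f : E2 -> \bar R) :
    measurable_fun setT V -> is_cond_law P V Z k -> measurable_fun setT f ->
  measurable_fun setT (fun w => \int[k (V w)]_z f z)%E.
Proof.
move=> mV [mk _] mf.
have ker (g : E2 -> \bar R) : measurable_fun setT g -> (forall z, 0 <= g z)%E ->
    measurable_fun setT (fun w => \int[k (V w)]_z g z)%E.
  move=> mg g0.
  apply: (@measurable_fun_integral_kernel _ _ _ _ _ (fun w => k (V w))) => //.
  by move=> B mB; exact: measurableT_comp (mk _ mB) mV.
under eq_fun do rewrite integralE.
by apply: emeasurable_funB; apply: ker => //;
  [exact: measurable_funepos|exact: measurable_funeneg].
Qed.

(** The positive and negative parts are treated separately. Integrability along [Z] passes to the
    kernel integrals of both parts, so their difference may be recombined under one integral. *)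
Lemma cond_law_integral_signed {d d1 d2} {Omega : measurableType d}
    {E1 : measurableType d1} {E2 : measurableType d2} {R : realType}
    (P : probability Omega R) (V : Omega -> E1) (Z : Omega -> E2)
    (k : E1 -> probability E2 R) (f : E2 -> \bar R) :
    measurable_fun setT V -> measurable_fun setT Z -> is_cond_law P V Z k ->
    measurable_fun setT f -> P.-integrable setT (f \o Z) ->
  (\int[P]_w f (Z w) = \int[P]_w \int[k (V w)]_z f z)%E.
Proof.
move=> mV mZ VZk mf fZ.
have mfp : measurable_fun setT (f^\+)%E by exact: measurable_funepos.
have mfn : measurable_fun setT (f^\-)%E by exact: measurable_funeneg.
have ker (g : E2 -> \bar R) : measurable_fun setT g -> (forall z, 0 <= g z)%E ->
    P.-integrable setT (g \o Z) ->
    P.-integrable setT (fun w => \int[k (V w)]_z g z)%E.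
  move=> mg g0 gZ; apply/integrableP; split.
    exact: (measurable_cond_law_integral mV VZk).
  rewrite (eq_integral (fun w => \int[k (V w)]_z g z))%E; last first.
    by move=> w _; rewrite gee0_abs//; exact: integral_ge0.
  rewrite -(cond_law_integral mV mZ VZk)//; move/integrableP : gZ => [_].
  by rewrite (eq_integral (g \o Z))// => w _; rewrite gee0_abs//=.
have fpE : (f^\+ \o Z = (f \o Z)^\+)%E by apply/funext => w; rewrite /= !funeposE.
have fnE : (f^\- \o Z = (f \o Z)^\-)%E by apply/funext => w; rewrite /= !funenegE.
have fp : P.-integrable setT (f^\+ \o Z)%E by rewrite fpE; exact: integrable_funepos.
have fn : P.-integrable setT (f^\- \o Z)%E by rewrite fnE; exact: integrable_funeneg.
rewrite -[LHS]/(\int[P]_w (f \o Z) w)%E integralE -fpE -fnE.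
rewrite !(cond_law_integral mV mZ VZk)// -integralB//; [|exact: ker..].
by apply: eq_integral => w _; rewrite [RHS]integralE.
Qed.

(** * Product probabilities: images, marginals and exchange of factors *)

Section product_probability_maps.
Context {d1 d2 d3} {E1 : measurableType d1} {E2 : measurableType d2}
  {E3 : measurableType d3} {R : realType}.
Local Open Scope ereal_scope.

Lemma product_prob_map_snd (m1 : probability E1 R) (m2 : probability E2 R)
    (m3 : probability E3 R) (h : E2 -> E3) :
    (forall B, measurable B -> m3 B = m2 (h @^-1` B)) ->
  forall B, measurable B ->
    (m1 \x m3) B = (m1 \x m2) ((fun p => (p.1, h p.2)) @^-1` B).
Proof.
move=> m23 B mB; rewrite /product_measure1; apply: eq_integral => x _ /=.
rewrite m23; last exact: measurable_xsection.
congr (m2 _); apply/seteqP; split => y /=; rewrite /xsection/= !inE//.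
Qed.

Lemma product_prob_fst (m1 : probability E1 R) (m2 : probability E2 R) B :
  measurable B -> m1 B = (m1 \x m2) (fst @^-1` B).
Proof.
move=> mB; rewrite (_ : fst @^-1` B = B `*` setT); last first.
  by apply/seteqP; split => -[x y] //= [].
by rewrite product_measure1E// -[X in _ * X]/(m2 setT) probability_setT mule1.
Qed.

Lemma product_prob_snd (m1 : probability E1 R) (m2 : probability E2 R) B :
  measurable B -> m2 B = (m1 \x m2) (snd @^-1` B).
Proof.
move=> mB; rewrite (_ : snd @^-1` B = setT `*` B); last first.
  by apply/seteqP; split => -[x y] //= [].
by rewrite product_measure1E// -[X in X * _]/(m1 setT) probability_setT mul1e.
Qed.

(** The image of the exchanged product agrees with [m1 \x m2] on rectangles, and a product measure
    is determined by its rectangles. *)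
Lemma product_prob_swap (m1 : probability E1 R) (m2 : probability E2 R) B :
  measurable B -> (m1 \x m2) B = (m2 \x m1) ((fun p => (p.2, p.1)) @^-1` B).
Proof.
move=> mB.
have msw : measurable_fun setT (fun p : E2 * E1 => (p.2, p.1)) by exact: measurable_swap.
pose m : {measure set (E1 * E2) -> \bar R} :=
  measure_function_pushforward__canonical__measure_function_Measure (m2 \x m1) msw.
apply: (@product_measure_unique _ _ _ _ _ m1 m2 m) => // A1 A2 mA1 mA2.
rewrite /m /= /pushforward (_ : _ @^-1` _ = A2 `*` A1); last first.
  by apply/seteqP; split => -[x y] /= [].
by rewrite product_measure1E// muleC.
Qed.

End product_probability_maps.

(** * Cancellation of skew-symmetric integrands *)

Section skew_symmetric_integrand.
Context {d dV dS dE} {Omega : measurableType d} {EV : measurableType dV}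
  {S : measurableType dS} {E : measurableType dE} {R : realType}
  (P : probability Omega R).
Variables (V : Omega -> EV) (u : Omega -> S) (X Y : Omega -> E).
Variables (Q : EV -> probability S R) (g : EV -> probability E R).
Hypotheses (mV : measurable_fun setT V) (mu : measurable_fun setT u)
  (mX : measurable_fun setT X) (mY : measurable_fun setT Y).
Hypothesis hlaw : is_cond_law P V (fun w => (u w, (X w, Y w)))
  (fun t => (Q t \x (g t \x g t))%E : probability _ R).

(** Given [V], the two attributes are independent with the same law [g t], so exchanging them leaves
    [g t \x g t] invariant. *)
Lemma cond_law_swap : is_cond_law P V (fun w => (u w, (Y w, X w)))
  (fun t => (Q t \x (g t \x g t))%E : probability _ R).
Proof.
apply: (cond_law_comp (g := fun p : S * (E * E) => (p.1, (p.2.2, p.2.1))) hlaw).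
  apply: measurable_fun_pair => //; apply: measurable_fun_pair => //.
  - exact: measurableT_comp.
  - exact: measurableT_comp.
move=> t B mB.
apply: (@product_prob_map_snd _ _ _ _ _ _ _ (Q t) (g t \x g t)%E (g t \x g t)%E
  (fun p : E * E => (p.2, p.1))) => //.
by move=> B' mB'; exact: product_prob_swap.
Qed.

(* Exchanging X and Y preserves the joint law of everything and every event of
   sigma(V, u), but changes the sign of the integrand. *)
Lemma integral_skew_eq0 (f : S -> E -> E -> R) (A : set Omega) :
    measurable_fun setT (fun p : S * (E * E) => f p.1 p.2.1 p.2.2) ->
    (forall z x y, f z y x = - f z x y) ->
    P.-integrable setT (fun w => (f (u w) (X w) (Y w))%:E) ->
    preimage_set_system setT (fun w => (V w, u w)) measurable A ->
  (\int[P]_(w in A) (f (u w) (X w) (Y w))%:E = 0)%E.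
Proof.
move=> mf skf intf [D mD <-]; rewrite setTI.
pose Z w := (u w, (X w, Y w)); pose Z' w := (u w, (Y w, X w)).
have mZ : measurable_fun setT Z.
  by apply: measurable_fun_pair => //; exact: measurable_fun_pair.
have mZ' : measurable_fun setT Z'.
  by apply: measurable_fun_pair => //; exact: measurable_fun_pair.
pose F (p : EV * (S * (E * E))) := (f p.2.1 p.2.2.1 p.2.2.2)%:E.
have mF : measurable_fun setT F.
  by apply/measurable_EFinP; apply: (measurableT_comp mf); exact: measurable_snd.
(* [D] is lifted to a condition that ignores the attributes, so its preimages under [(V, Z)] and
   [(V, Z')] are the same event of Omega. *)
pose D' : set (EV * (S * (E * E))) := (fun p => (p.1, p.2.1)) @^-1` D.
have mD' : measurable D'.
  rewrite -[D']setTI.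
  suff : measurable_fun [set: EV * (S * (E * E))] (fun p => (p.1, p.2.1)) by exact.
  by apply: measurable_fun_pair => //; exact: measurableT_comp.
have E0 : (fun w => F (V w, Z' w)) = (\- (fun w => F (V w, Z w)))%E.
  by apply/funext => w; rewrite /F /= skf EFinN.
have intF : P.-integrable setT (fun w => F (V w, Z w)) by [].
have intF' : P.-integrable setT (fun w => F (V w, Z' w)).
  by rewrite E0; exact: integrableN.
have := cond_law_joint_integral mV mZ hlaw mZ' cond_law_swap mD' mF intF intF'.
have mA : measurable ((fun w => (V w, u w)) @^-1` D).
  have : measurable_fun setT (fun w => (V w, u w)) by exact: measurable_fun_pair.
  by move=> /(_ measurableT _ mD); rewrite setTI.
have intA := integrableS measurableT mA (@subsetT _ _) intF.
rewrite [in X in _ = X -> _]E0 integralN; last first.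
  exact: integrable_add_def intA.
pose I := (\int[P]_(w in (fun w => (V w, u w)) @^-1` D) F (V w, Z w))%E.
change (I = (- I)%E -> I = 0%E).
have /fineK <- : I \is a fin_num := integrable_fin_num mA intA.
by rewrite -EFinN => -[] h; congr EFin; move/eqP: h;
  rewrite -addr_eq0 -mulr2n mulrn_eq0/= => /eqP.
Qed.

End skew_symmetric_integrand.

(** Preimages of measurable sets already form a sigma-algebra, so only the generators have to be
    checked. *)
Lemma preimage_generated_sub {d d'} {Omega : measurableType d} {E : measurableType d'}
    (X : Omega -> E) (C : set (set Omega)) :
    C `<=` preimage_set_system setT X measurable ->
  <<s C >> `<=` preimage_set_system setT X measurable.
Proof.
apply: smallest_sub; apply: sigma_algebra_preimage.
exact: sigma_algebra_measurable.
Qed.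

Lemma preimage_set_system_comp_sub {d1 d2 d3} {Omega : measurableType d1}
    {E : measurableType d2} {E' : measurableType d3} (X : Omega -> E) (g : E -> E') :
    measurable_fun setT g ->
  preimage_set_system setT (g \o X) measurable `<=`
  preimage_set_system setT X measurable.
Proof.
move=> mg _ [B mB <-]; exists (g @^-1` B) => //.
by rewrite -[X in measurable X]setTI; exact: mg.
Qed.

(** Used with [h] equal to [fst] or [snd], where the hypothesis on [g] is the marginal property of a
    product. It reduces three attributes to the two that the exchange argument handles. *)
Lemma cond_law_project {d dV dS dE} {Omega : measurableType d}
    {EV : measurableType dV} {S : measurableType dS} {E : measurableType dE}
    {R : realType} (P : probability Omega R) (V : Omega -> EV) (u : Omega -> S)
    (X Y W : Omega -> E) (Q : EV -> probability S R) (g : EV -> probability E R)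
    (h : E * E -> E) :
    measurable_fun setT h ->
    (forall t B, measurable B -> g t B = (g t \x g t)%E (h @^-1` B)) ->
    is_cond_law P V (fun w => (u w, (X w, (Y w, W w))))
      (fun t => (Q t \x (g t \x (g t \x g t)))%E : probability _ R) ->
  is_cond_law P V (fun w => (u w, (X w, h (Y w, W w))))
    (fun t => (Q t \x (g t \x g t))%E : probability _ R).
Proof.
move=> mh gh hlaw.
apply: (cond_law_comp (g := fun p : S * (E * (E * E)) => (p.1, (p.2.1, h p.2.2))) hlaw).
  apply: measurable_fun_pair => //; apply: measurable_fun_pair => //.
  - exact: measurableT_comp.
  - by apply: measurableT_comp => //; exact: measurableT_comp.
move=> t B mB.
apply: (@product_prob_map_snd _ _ _ _ _ _ _ (Q t) (g t \x (g t \x g t))%E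
  (g t \x g t)%E (fun p : E * (E * E) => (p.1, h p.2))) => // B' mB'.
apply: (@product_prob_map_snd _ _ _ _ _ _ _ (g t) (g t \x g t)%E (g t) h) => //.
exact: gh.
Qed.

(** * Gaussian integrals *)

(** Put c = 1 + 2 a s^2. As a function of w, the sum of exponents is that of a normal density with
    mean 2 a s^2 x / c and variance s^2 / c, up to the remainder -(a / c) x^2. The subtracted 0 is
    the mean in [normal_fun]. *)
Lemma complete_square (F : realFieldType) (a s x w : F) :
  1 + 2 * a * s ^+ 2 != 0 -> s != 0 ->
  - (a * (x - w) ^+ 2) + - (w - 0) ^+ 2 / (s ^+ 2 *+ 2) =
  - (a / (1 + 2 * a * s ^+ 2) * x ^+ 2) +
  - (w - 2 * a * s ^+ 2 * x / (1 + 2 * a * s ^+ 2)) ^+ 2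
    / (s ^+ 2 / (1 + 2 * a * s ^+ 2) *+ 2).
Proof.
move=> c0 s0. field. 
by rewrite c0 s0.
Qed.

Section gaussian_integrals.
Context {R : realType}.
Implicit Types (a s m : R).

(** The explicit density has the same integral over every measurable set as the Radon-Nikodym
    derivative, hence equals it almost everywhere. *)
Lemma integral_normal_prob m s (f : measurableTypeR R -> \bar R) :
    measurable_fun setT f -> (forall x, 0 <= f x)%E ->
  (\int[normal_prob m s]_x f x =
   \int[lebesgue_measure]_x (f x * (normal_pdf m s x)%:E))%E.
Proof.
move=> mf f0; have dom := normal_prob_dominates m s.
rewrite -(Radon_Nikodym_SigmaFinite.change_of_variables dom f0 measurableT mf).
have mpdf : measurable_fun setT (fun x => (normal_pdf m s x)%:E).
  by apply/measurable_EFinP; exact: measurable_normal_pdf.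
have intRN := Radon_Nikodym_SigmaFinite.f_integrable dom.
apply: ae_eq_integral => //.
- by apply: emeasurable_funM => //; exact: measurable_int intRN.
- exact: emeasurable_funM.
- apply: ae_eqe_mul2l; apply: integral_ae_eq => // E _ mE.
  by rewrite -Radon_Nikodym_SigmaFinite.f_integral.
Qed.

Let den_gt0 a s : 0 <= a -> 0 < 1 + 2 * a * s ^+ 2.
Proof. by move=> a0; rewrite ltr_pwDl// mulr_ge0 ?sqr_ge0 ?mulr_ge0. Qed.

(** The square is completed inside the density. The factor c^(-1/2), with c = 1 + 2 a s^2, is the
    ratio of the normalising constants of the old and the new standard deviations [s] and s / sqrt
    c. *)
Let expRsq_normal_pdf a s x w : 0 <= a -> 0 < s ->
  expR (- (a * (x - w) ^+ 2)) * normal_pdf 0 s w =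
  (1 + 2 * a * s ^+ 2) `^ (- (1 / 2))
    * expR (- (a / (1 + 2 * a * s ^+ 2) * x ^+ 2))
    * normal_pdf (2 * a * s ^+ 2 * x / (1 + 2 * a * s ^+ 2))
                 (s / Num.sqrt (1 + 2 * a * s ^+ 2)) w.
Proof.
move=> a0 s0; set c := 1 + 2 * a * s ^+ 2.
have c0 : 0 < c := den_gt0 s a0.
have sc0 : 0 < Num.sqrt c by rewrite sqrtr_gt0.
rewrite !normal_pdfE ?gt_eqF ?divr_gt0// /normal_peak /normal_fun.
have -> : c `^ (- (1 / 2)) = (Num.sqrt c)^-1.
  by rewrite powRN div1r powR12_sqrt// ltW.
have -> : (s / Num.sqrt c) ^+ 2 = s ^+ 2 / c.
  by rewrite expr_div_n sqr_sqrtr// ltW.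
have -> : Num.sqrt (s ^+ 2 * pi *+ 2) = Num.sqrt c * Num.sqrt (s ^+ 2 / c * pi *+ 2).
  rewrite -sqrtrM ?ltW//; congr Num.sqrt.
  by rewrite [RHS]mulrnAr [c * (_ * _)]mulrA [c * (_ / _)]mulrC divfK ?gt_eqF.
rewrite invfM mulrCA -expRD complete_square ?gt_eqF// expRD.
by rewrite mulrACA.
Qed.

Lemma normal_integral_expRsq a s (x : R) : 0 <= a -> 0 < s ->
  (\int[normal_prob 0 s]_w (expR (- (a * (x - w) ^+ 2)))%:E =
   ((1 + 2 * a * s ^+ 2) `^ (- (1 / 2))
     * expR (- (a / (1 + 2 * a * s ^+ 2) * x ^+ 2)))%:E)%E.
Proof.
move=> a0 s0; rewrite integral_normal_prob; last 2 first.
- apply/measurable_EFinP; apply: measurableT_comp => //.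
  apply: measurableT_comp => //; apply: measurable_funM => //.
  by apply: measurable_funX; exact: measurable_funB.
- by move=> w; rewrite lee_fin expR_ge0.
under eq_integral do rewrite -EFinM expRsq_normal_pdf// EFinM.
rewrite ge0_integralZl//.
- by rewrite integral_normal_pdf mule1.
- by apply/measurable_EFinP; exact: measurable_normal_pdf.
- by move=> w _; rewrite lee_fin normal_pdf_ge0.
- by rewrite lee_fin mulr_ge0 ?powR_ge0 ?expR_ge0.
Qed.

Lemma measurable_sqdist d (E : measurableType d) n (f g : E -> n.-tuple R) :
  measurable_fun setT f -> measurable_fun setT g ->
  measurable_fun setT (fun t => sqdist (f t) (g t)).
Proof.
move=> mf mg; apply: measurable_sum => i.
by apply: measurable_funX; apply: measurable_funB;
  apply: (measurableT_comp (measurable_tnth i)).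
Qed.

(** Induction follows the coordinatewise construction of [iid_prob]: each coordinate contributes one
    factor c^(-1/2). The squared norm of [x] is written as a distance to the origin so that the
    result has the shape of the integrand and can be integrated again. *)
Lemma gaussian_integral_expRsqdist n a s (x : n.-tuple R) : 0 <= a -> 0 < s ->
  (\int[isotropic_gaussian n s]_w (expR (- (a * sqdist x w)))%:E =
   ((1 + 2 * a * s ^+ 2) `^ (- (n%:R / 2))
     * expR (- (a / (1 + 2 * a * s ^+ 2) * sqdist x [tuple of nseq n 0])))%:E)%E.
Proof.
move=> a0 s0; set c := 1 + 2 * a * s ^+ 2.
have c0 : 0 < c := den_gt0 s a0.
elim: n x => [x|n IH].
  rewrite (eq_integral (cst 1%E)); last first.
    by move=> w _; rewrite /sqdist big_ord0 mulr0 oppr0 expR0.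
  rewrite integral_cst// /sqdist big_ord0 mul0r oppr0 powRr0 mulr0 oppr0 expR0.
  by rewrite mulr1 mul1e; exact: probability_setT.
case/tupleP => x0 x.
have sqdist_cons (y0 : R) (y : n.-tuple R) :
    sqdist [tuple of x0 :: x] [tuple of y0 :: y] = (x0 - y0) ^+ 2 + sqdist x y.
  rewrite /sqdist big_ord_recl !tnth0; congr (_ + _).
  by apply: eq_bigr => i _; rewrite !tnthS.
rewrite /isotropic_gaussian /= ge0_integral_distribution; last 2 first.
- apply/measurable_EFinP; apply: measurableT_comp => //.
  apply: measurableT_comp => //; apply: measurable_funM => //.
  exact: measurable_sqdist.
- by move=> w; rewrite lee_fin expR_ge0.
rewrite fubini_tonelli1/=; last 2 first.
- apply/measurable_EFinP; apply: measurableT_comp => //.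
  apply: measurableT_comp => //; apply: measurable_funM => //.
  apply: measurable_sqdist => //; exact: measurable_cons_coord.
- by move=> w; rewrite lee_fin expR_ge0.
rewrite /fubini_F/=.
transitivity (\int[normal_prob 0 s]_w0 ((expR (- (a * (x0 - w0) ^+ 2)))%:E
    * (c `^ (- (n%:R / 2)) * expR (- (a / c * sqdist x [tuple of nseq n 0])))%:E))%E.
  apply: eq_integral => w0 _; rewrite -IH -ge0_integralZl//.
  - by apply: eq_integral => w _; rewrite sqdist_cons mulrDr opprD expRD EFinM.
  - apply/measurable_EFinP; apply: measurableT_comp => //.
    apply: measurableT_comp => //; apply: measurable_funM => //.
    exact: measurable_sqdist.
rewrite ge0_integralZr//; last 2 first.
- apply/measurable_EFinP; apply: measurableT_comp => //.
  apply: measurableT_comp => //; apply: measurable_funM => //.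
  by apply: measurable_funX; exact: measurable_funB.
- by rewrite lee_fin mulr_ge0 ?powR_ge0 ?expR_ge0.
rewrite normal_integral_expRsq// -/c -EFinM; congr EFin.
rewrite [X in _ = _ * expR (- (_ * X))](_ : _ =
    x0 ^+ 2 + sqdist x [tuple of nseq n 0]); last first.
  by rewrite -[in RHS](subr0 x0) -sqdist_cons; congr (sqdist _ _); exact: val_inj.
rewrite mulrDr opprD expRD mulrACA; congr (_ * _).
rewrite -powRD; last by rewrite (gt_eqF c0); exact/implybT.
by congr (_ `^ _); rewrite -opprD -mulrDl -[in RHS]natr1 [1 + _]addrC.
Qed.

Lemma measurable_expRsqdist d (E : measurableType d) n a (f g : E -> n.-tuple R) :
  measurable_fun setT f -> measurable_fun setT g ->
  measurable_fun setT (fun t => expR (- (a * sqdist (f t) (g t)))).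
Proof.
move=> mf mg; apply: measurableT_comp => //; apply: measurableT_comp => //.
by apply: measurable_funM => //; exact: measurable_sqdist.
Qed.

Lemma sqdistC n (x y : n.-tuple R) : sqdist x y = sqdist y x.
Proof. by apply: eq_bigr => i _; rewrite -opprB sqrrN. Qed.

Lemma sqdistxx n (x : n.-tuple R) : sqdist x x = 0.
Proof. by rewrite /sqdist big1// => i _; rewrite subrr expr0n. Qed.

Lemma sqdist_ge0 n (x y : n.-tuple R) : 0 <= sqdist x y.
Proof. by apply: sumr_ge0 => i _; exact: sqr_ge0. Qed.

Lemma gaussian_integral_expRsqdist0 n a s : 0 <= a -> 0 < s ->
  (\int[isotropic_gaussian n s]_w (expR (- (a * sqdist w [tuple of nseq n 0])))%:E =
   ((1 + 2 * a * s ^+ 2) `^ (- (n%:R / 2)))%:E)%E.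
Proof.
move=> a0 s0; under eq_integral do rewrite sqdistC.
by rewrite gaussian_integral_expRsqdist// sqdistxx mulr0 oppr0 expR0 mulr1.
Qed.

(** With c = 1 + 2 a s^2, integrating [y] leaves the rate a / c in [x]. Integrating [x] then
    multiplies the bases: c (1 + 2 (a / c) s^2) = 1 + 4 a s^2. *)
Lemma gaussian_integral2 n a s : 0 <= a -> 0 < s ->
  (\int[isotropic_gaussian n s]_x \int[isotropic_gaussian n s]_y
     (expR (- (a * sqdist x y)))%:E =
   ((1 + 4 * a * s ^+ 2) `^ (- (n%:R / 2)))%:E)%E.
Proof.
move=> a0 s0; have c0 := den_gt0 s a0.
under eq_integral do rewrite gaussian_integral_expRsqdist// EFinM.
rewrite ge0_integralZl//; last 2 first.
- by apply/measurable_EFinP; exact: measurable_expRsqdist.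
- by rewrite lee_fin powR_ge0.
rewrite gaussian_integral_expRsqdist0 ?divr_ge0 ?(ltW c0)// -EFinM -powRM ?(ltW c0)//.
  by congr ((_ `^ _)%:E); field; rewrite gt_eqF.
by rewrite ltW// den_gt0// divr_ge0// ltW.
Qed.

(** For fixed [x] the integrals over [y] and [w] factor, each giving [K] and the rate a / c. The
    joint rate 2 a / c merges with one [K] through c (1 + 4 (a / c) s^2) = 1 + 6 a s^2; the other
    [K] survives as the first factor. *)
Lemma gaussian_integral3 n a s : 0 <= a -> 0 < s ->
  (\int[isotropic_gaussian n s]_x \int[isotropic_gaussian n s]_y
     \int[isotropic_gaussian n s]_w
     (expR (- (a * sqdist x y)) * expR (- (a * sqdist x w)))%:E =
   ((1 + 2 * a * s ^+ 2) `^ (- (n%:R / 2))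
     * (1 + 6 * a * s ^+ 2) `^ (- (n%:R / 2)))%:E)%E.
Proof.
move=> a0 s0; have c0 := den_gt0 s a0; set c := 1 + 2 * a * s ^+ 2 in c0 *.
set K := c `^ (- (n%:R / 2)).
have K0 : 0 <= K by exact: powR_ge0.
transitivity (\int[isotropic_gaussian n s]_x ((K * K)%:E *
    (expR (- (2 * (a / c) * sqdist x [tuple of nseq n 0])))%:E))%E.
  apply: eq_integral => x _.
  transitivity (\int[isotropic_gaussian n s]_y ((expR (- (a * sqdist x y)))%:E *
    (K * expR (- (a / c * sqdist x [tuple of nseq n 0])))%:E))%E.
    apply: eq_integral => y _; rewrite -gaussian_integral_expRsqdist//.
    rewrite -ge0_integralZl//.
    by apply/measurable_EFinP; exact: measurable_expRsqdist.
  rewrite ge0_integralZr//; last 2 first.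
  - by apply/measurable_EFinP; exact: measurable_expRsqdist.
  - by rewrite lee_fin mulr_ge0// expR_ge0.
  rewrite gaussian_integral_expRsqdist// -/c -/K -!EFinM mulrACA -expRD.
  by congr ((_ * expR _)%:E); rewrite -opprD -mulrDl -mulr2n mulr_natl.
rewrite ge0_integralZl//; last 2 first.
- by apply/measurable_EFinP; exact: measurable_expRsqdist.
- by rewrite lee_fin mulr_ge0.
have ac0 : 0 <= 2 * (a / c) by rewrite mulr_ge0// divr_ge0// ltW.
rewrite gaussian_integral_expRsqdist0// -EFinM -[X in X%:E = _]mulrA.
congr ((K * _)%:E).
rewrite /K -powRM; [|exact: ltW|exact/ltW/den_gt0].
by congr (_ `^ _); rewrite /c; field; rewrite gt_eqF.
Qed.

End gaussian_integrals.

(** * Moments of the skew-symmetric part *)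

Section second_moments.
Context {d} {T : measurableType d} {R : realType} (mu : probability T R).

Lemma sqr_integrableM (f g : T -> R) :
    measurable_fun setT f -> measurable_fun setT g ->
    (\int[mu]_x (f x ^+ 2)%:E < +oo)%E -> (\int[mu]_x (g x ^+ 2)%:E < +oo)%E ->
  mu.-integrable setT (EFin \o (f \* g)).
Proof.
move=> mf mg f2 g2.
have i2 (h : T -> R) : measurable_fun setT h -> (\int[mu]_x (h x ^+ 2)%:E < +oo)%E ->
    mu.-integrable setT (fun x => (h x ^+ 2)%:E).
  move=> mh h2; apply/integrableP; split.
    by apply/measurable_EFinP; exact: measurable_funX.
  rewrite (eq_integral (fun x => (h x ^+ 2)%:E))// => x _.
  by rewrite gee0_abs// lee_fin sqr_ge0.
apply: (le_integrable measurableT _ _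
  (integrableD measurableT (i2 _ mf f2) (i2 _ mg g2))).
  by apply/measurable_EFinP; exact: measurable_funM.
move=> x _; rewrite /= lee_fin [leRHS]ger0_norm ?addr_ge0 ?sqr_ge0//.
(* These squares give the domination of |f g| by f^2 + g^2. *)
have := sqr_ge0 (`|f x| - `|g x|); have := sqr_ge0 (`|f x| + `|g x|).
rewrite normrM -(real_normK (num_real (f x))) -(real_normK (num_real (g x))).
move: (normr_ge0 (f x)) (normr_ge0 (g x)); nra.
Qed.

Lemma sqr_integrable (f : T -> R) : measurable_fun setT f ->
  (\int[mu]_x (f x ^+ 2)%:E < +oo)%E -> mu.-integrable setT (EFin \o f).
Proof.
move=> mf f2; have := @sqr_integrableM f (cst 1) mf (measurable_cst _) f2.
rewrite (_ : f \* cst 1 = f); last by apply/funext => x; rewrite /= mulr1.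
apply; under eq_integral do rewrite /= expr1n.
by rewrite integral_cst// mul1e -[X in (X < _)%E]/(mu setT) probability_setT ltry.
Qed.

(** Functions with values in [0, 1] are integrable for a probability, so linearity applies. This
    serves both the exponentials in the attributes and the powers of the roughness. *)
Lemma integral_scale_sub01 (v : R) (f g : T -> R) :
    measurable_fun setT f -> measurable_fun setT g ->
    (forall x, 0 <= f x <= 1) -> (forall x, 0 <= g x <= 1) ->
  (\int[mu]_x (v * (f x - g x))%:E =
   (v * (fine (\int[mu]_x (f x)%:E) - fine (\int[mu]_x (g x)%:E)))%:E)%E.
Proof.
move=> mf mg f01 g01.
have i01 (h : T -> R) : measurable_fun setT h -> (forall x, 0 <= h x <= 1) ->
    mu.-integrable setT (EFin \o h).
  move=> mh h01; apply: (le_integrable measurableT _ _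
    (finite_measure_integrable_cst mu 1 measurableT)) => //.
    exact/measurable_EFinP.
  move=> x _; rewrite /= lee_fin normr1.
  by have /andP[h0 h1] := h01 x; rewrite ger0_norm.
have intf := i01 _ mf f01; have intg := i01 _ mg g01.
under eq_integral do rewrite EFinM EFinB.
rewrite integralZl//; last exact: integrableB.
rewrite integralB_EFin// EFinM EFinB !fineK//; exact: integrable_fin_num.
Qed.

End second_moments.

Section product_second_moments.
Context {d1 d2} {S : measurableType d1} {E : measurableType d2} {R : realType}.
Variables (q : probability S R) (mu : probability E R).
Variables (f g : S * E -> R) (c : E -> R) (M : R).
Hypotheses (mf : measurable_fun setT f) (mg : measurable_fun setT g).
Hypotheses (fM : forall e, (\int[q]_z (f (z, e) ^+ 2)%:E <= M%:E)%E)
           (gM : forall e, (\int[q]_z (g (z, e) ^+ 2)%:E <= M%:E)%E).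
Hypothesis fgc : forall e, (\int[q]_z (f (z, e) * g (z, e))%:E = (c e)%:E)%E.

Let sqr_lty (h : S * E -> R) : measurable_fun setT h ->
    (forall e, (\int[q]_z (h (z, e) ^+ 2)%:E <= M%:E)%E) ->
  (\int[q \x mu]_p (h p ^+ 2)%:E < +oo)%E.
Proof.
move=> mh hM.
have mh2 : measurable_fun setT (fun p => (h p ^+ 2)%:E).
  by apply/measurable_EFinP; exact: measurable_funX.
have h0 p : (0 <= (h p ^+ 2)%:E)%E by rewrite lee_fin sqr_ge0.
rewrite fubini_tonelli2//.
apply: (@le_lt_trans _ _ (\int[mu]_e M%:E)%E).
  apply: ge0_le_integral => //.
  - by move=> e _; apply: integral_ge0.
  - exact: measurable_fun_fubini_tonelli_G.
  - by move=> e _; exact: hM.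
by rewrite integral_cst// [X in (_ * X)%E](_ : _ = 1%E) ?mule1 ?ltry//;
  exact: probability_setT.
Qed.

(** The bound [M], uniform in the attributes, puts [f] and [g] in L2 of the product, so Fubini
    applies to the signed product, with the integral over the utility taken inside. *)
Lemma integral_product_second_moment :
  (\int[q \x mu]_p (f p * g p)%:E = \int[mu]_e (c e)%:E)%E.
Proof.
have ifg : (q \x mu)%E.-integrable setT (EFin \o (f \* g)).
  by apply: sqr_integrableM => //; exact: sqr_lty.
rewrite -(integral21_prod_meas1 ifg).
by apply: eq_integral => e _; rewrite /fubini_G /= fgc.
Qed.

End product_second_moments.

Section skew_covariance.
Context {dS} {S : measurableType dS} {R : realType} {T : nat}.
Variables (q : probability S R) (U : S -> T.-tuple R * T.-tuple R -> R).
Variables (su l : R).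
Hypothesis UL2 : forall p, (fun z => U z p) \in Lfun q 2%:E.
Hypothesis Ucov : forall p p',
  covariance q (fun z => U z p) (fun z => U z p') = (se_kernel su l p p')%:E.
Hypothesis Fmean : forall x y, ('E_q[fun z => skew_part (U z) x y] = 0)%E.

Let k := @se_kernel R T su l.

(** Only the skew parts are assumed centred, not the utility. Their product therefore integrates to
    their covariance, which bilinearity expands into four kernel values. *)
Lemma expectation_skew_partM x y x' y' :
  (\int[q]_z (skew_part (U z) x y * skew_part (U z) x' y')%:E =
   (k (x, y) (x', y') - k (x, y) (y', x')
     - (k (y, x) (x', y') - k (y, x) (y', x')))%:E)%E.
Proof.
pose u p z := U z p.
have FE a b : (fun z => skew_part (U z) a b) = (u (a, b) \- u (b, a))%R by [].
have uL p : u p \in Lfun q 2%:E by exact: UL2.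
have F2 a b : (fun z => skew_part (U z) a b) \in Lfun q 2%:E.
  by rewrite FE; apply: rpredB => [|?|?]; [rewrite lee1n|exact: uL|exact: uL].
have qfin : q setT \is a fin_num by exact: fin_num_measure.
have F1 a b := Lfun_subset12 qfin (F2 a b).
have := covarianceE (F1 x y) (F1 x' y') (Lfun2_mul_Lfun1 (F2 x y) (F2 x' y')).
rewrite !Fmean mule0 sube0 [in X in _ = X -> _]unlock => <-.
rewrite !FE covarianceBl ?covarianceBr ?rpredB ?lee1n//=.
by rewrite !Ucov !EFinB.
Qed.

Let a := (2 * l ^+ 2)^-1.

(** The shared endpoint cancels one distance in each of the two positive terms, leaving e(y,w)
    twice; both negative terms equal e(x,y) e(x,w). This is the source of the factor 2. *)
Let skew_partM x y w :
  k (x, y) (x, w) - k (x, y) (w, x) - (k (y, x) (x, w) - k (y, x) (w, x)) =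
  2 * su ^+ 2 * (expR (- (a * sqdist y w))
    - expR (- (a * sqdist x y)) * expR (- (a * sqdist x w))).
Proof.
rewrite /k /se_kernel /= !sqdistxx add0r addr0 -expRD -opprD -mulrDr.
rewrite (sqdistC y x) [sqdist x w + _]addrC ![_ / _]mulrC -/a; ring.
Qed.

Lemma expectation_skew_part_shared x y w :
  (\int[q]_z (skew_part (U z) x y * skew_part (U z) x w)%:E =
   (2 * su ^+ 2 * (expR (- (a * sqdist y w))
      - expR (- (a * sqdist x y)) * expR (- (a * sqdist x w))))%:E)%E.
Proof. by rewrite expectation_skew_partM skew_partM. Qed.

(** This is the shared-endpoint formula at w = y; squaring e(x,y) doubles the rate to [2 * a]. *)
Lemma expectation_skew_part_sqr x y :
  (\int[q]_z (skew_part (U z) x y ^+ 2)%:E =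
   (2 * su ^+ 2 * (1 - expR (- ((2 * a) * sqdist x y))))%:E)%E.
Proof.
under eq_integral do rewrite expr2.
rewrite expectation_skew_part_shared sqdistxx mulr0 oppr0 expR0 -expRD.
by congr ((_ * (1 - expR _))%:E); rewrite -opprD -mulrDl -mulr2n mulr_natl.
Qed.

End skew_covariance.

Section iterated_integrals.
Context {d1 d2 d3} {E1 : measurableType d1} {E2 : measurableType d2}
  {E3 : measurableType d3} {R : realType}.

Lemma product_integral3 (m1 : probability E1 R) (m2 : probability E2 R)
    (m3 : probability E3 R) (f : E1 * (E2 * E3) -> \bar R) :
    measurable_fun setT f -> (forall p, 0 <= f p)%E ->
  (\int[m1 \x (m2 \x m3)]_p f p =
   \int[m1]_x \int[m2]_y \int[m3]_z f (x, (y, z)))%E.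
Proof.
move=> mf f0; pose m23 : probability (E2 * E3)%type R := (m2 \x m3)%E.
rewrite (@fubini_tonelli1 _ _ E1 (E2 * E3)%type R m1 m23)//.
apply: eq_integral => x _; rewrite /fubini_F/= fubini_tonelli1//.
by apply: (measurableT_comp mf); apply: measurable_fun_pair.
Qed.

End iterated_integrals.

Section skew_gaussian_moments.
Context {dS} {S : measurableType dS} {R : realType} {T : nat}.
Variables (q : probability S R) (U : S -> T.-tuple R * T.-tuple R -> R).
Variables (su s l : R).
Hypotheses (s0 : 0 < s) (l0 : 0 < l).
Hypothesis mU : measurable_fun setT (fun p => U p.1 p.2).
Hypothesis UL2 : forall p, (fun z => U z p) \in Lfun q 2%:E.
Hypothesis Ucov : forall p p',
  covariance q (fun z => U z p) (fun z => U z p') = (se_kernel su l p p')%:E.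
Hypothesis Fmean : forall x y, ('E_q[fun z => skew_part (U z) x y] = 0)%E.

Local Notation gam := (isotropic_gaussian T s).
Let v := 2 * su ^+ 2.
Let a := (2 * l ^+ 2)^-1.

Let v0 : 0 <= v. Proof. by rewrite mulr_ge0 ?sqr_ge0. Qed.

Let a0 : 0 <= a. Proof. by rewrite invr_ge0 mulr_ge0 ?sqr_ge0. Qed.

Let e01 b (x y : T.-tuple R) : 0 <= b -> 0 <= expR (- (b * sqdist x y)) <= 1.
Proof.
move=> b0; rewrite expR_ge0/= -expR0 ler_expR oppr_le0.
by rewrite mulr_ge0// sqdist_ge0.
Qed.

Lemma measurable_skew_part d (E : measurableType d) (g : E -> S) (x y : E -> T.-tuple R) :
  measurable_fun setT g -> measurable_fun setT x -> measurable_fun setT y ->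
  measurable_fun setT (fun e => skew_part (U (g e)) (x e) (y e)).
Proof.
move=> mg mx my; have mUg (x' y' : E -> T.-tuple R) : measurable_fun setT x' ->
    measurable_fun setT y' -> measurable_fun setT (fun e => U (g e) (x' e, y' e)).
  move=> mx' my'; apply: (measurableT_comp mU (measurable_fun_pair mg _)).
  exact: measurable_fun_pair.
by apply: measurable_funB; exact: mUg.
Qed.

(** Dropping the nonnegative exponential gives a bound free of the attributes, which is the [M]
    required for Fubini. *)
Let skew_sqr_le x y : (\int[q]_z (skew_part (U z) x y ^+ 2)%:E <= v%:E)%E.
Proof.
by rewrite (expectation_skew_part_sqr UL2 Ucov Fmean) lee_fin -/v ler_piMr//.
Qed.

(** The rate is 2 a = 1 / l^2 here, so the base 1 + 4 (2 a) s^2 of the double Gaussian integral is 1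
    + 4 (s / l)^2. *)
Lemma integral_skew_sqr :
  (\int[q \x (gam \x gam)]_p (skew_part (U p.1) p.2.1 p.2.2 ^+ 2)%:E =
   (v * (1 - (1 + 4 * (s / l) ^+ 2) `^ (- (T%:R / 2))))%:E)%E.
Proof.
have mF : measurable_fun setT (fun p : S * (T.-tuple R * T.-tuple R) =>
    skew_part (U p.1) p.2.1 p.2.2).
  by apply: measurable_skew_part => //; exact: measurableT_comp.
transitivity (\int[gam \x gam]_e (v * (1 - expR (- (2 * a * sqdist e.1 e.2))))%:E)%E.
  apply: (@integral_product_second_moment _ _ _ _ _ q (gam \x gam)%E _ _
    (fun e => v * (1 - expR (- (2 * a * sqdist e.1 e.2)))) v mF mF).
  - by move=> e; exact: skew_sqr_le.
  - by move=> e; exact: skew_sqr_le.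
  - by move=> e; exact: (expectation_skew_part_sqr UL2 Ucov Fmean).
have me : measurable_fun setT (fun e : T.-tuple R * T.-tuple R =>
    expR (- (2 * a * sqdist e.1 e.2))) by exact: measurable_expRsqdist.
rewrite (@integral_scale_sub01 _ _ _ (gam \x gam)%E v (cst 1))//=; last first.
- by move=> e; rewrite e01// mulr_ge0.
- by move=> e; rewrite ler01 lexx.
rewrite integral_cst// [X in fine (_ * X)](_ : _ = 1%E); last exact: probability_setT.
rewrite mul1e /= fubini_tonelli1//; last exact/measurable_EFinP.
rewrite /fubini_F/= gaussian_integral2 ?mulr_ge0//=.
congr ((_ * (1 - _ `^ _))%:E).
by rewrite /a; field; rewrite gt_eqF.
Qed.

(** Since 2 a s^2 = (s / l)^2, the Gaussian bases with coefficients 4, 2 and 6 of a s^2 become those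
    with coefficients 2, 1 and 3 of (s / l)^2. *)
Lemma integral_skew_shared :
  (\int[q \x (gam \x (gam \x gam))]_p
     (skew_part (U p.1) p.2.1 p.2.2.1 * skew_part (U p.1) p.2.1 p.2.2.2)%:E =
   (v * ((1 + 2 * (s / l) ^+ 2) `^ (- (T%:R / 2))
         - (1 + (s / l) ^+ 2) `^ (- (T%:R / 2))
           * (1 + 3 * (s / l) ^+ 2) `^ (- (T%:R / 2))))%:E)%E.
Proof.
have mF1 : measurable_fun setT (fun p : S * (T.-tuple R * (T.-tuple R * T.-tuple R)) =>
    skew_part (U p.1) p.2.1 p.2.2.1).
  apply: measurable_skew_part => //; first exact: measurableT_comp.
  by do 2 apply: measurableT_comp => //.
have mF2 : measurable_fun setT (fun p : S * (T.-tuple R * (T.-tuple R * T.-tuple R)) =>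
    skew_part (U p.1) p.2.1 p.2.2.2).
  apply: measurable_skew_part => //; first exact: measurableT_comp.
  by do 2 apply: measurableT_comp => //.
transitivity (\int[gam \x (gam \x gam)]_e (v * (expR (- (a * sqdist e.2.1 e.2.2))
     - expR (- (a * sqdist e.1 e.2.1)) * expR (- (a * sqdist e.1 e.2.2))))%:E)%E.
  apply: (@integral_product_second_moment _ _ _ _ _ q (gam \x (gam \x gam))%E _ _
    (fun e => v * (expR (- (a * sqdist e.2.1 e.2.2))
     - expR (- (a * sqdist e.1 e.2.1)) * expR (- (a * sqdist e.1 e.2.2)))) v mF1 mF2).
  - by move=> e; exact: skew_sqr_le.
  - by move=> e; exact: skew_sqr_le.
  - by move=> e; exact: (expectation_skew_part_shared UL2 Ucov Fmean).
have me1 : measurable_fun setT (fun e : T.-tuple R * (T.-tuple R * T.-tuple R) =>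
    expR (- (a * sqdist e.2.1 e.2.2))).
  by apply: measurable_expRsqdist; exact: measurableT_comp.
have me2 : measurable_fun setT (fun e : T.-tuple R * (T.-tuple R * T.-tuple R) =>
    expR (- (a * sqdist e.1 e.2.1)) * expR (- (a * sqdist e.1 e.2.2))).
  by apply: measurable_funM; apply: measurable_expRsqdist => //; exact: measurableT_comp.
rewrite (@integral_scale_sub01 _ _ _ (gam \x (gam \x gam))%E v)//=; last first.
- move=> e; have /andP[f0 f1] := e01 e.1 e.2.1 a0.
  have /andP[g0 g1] := e01 e.1 e.2.2 a0.
  by rewrite mulr_ge0//= mulr_ile1.
- by move=> e; exact: e01.
rewrite !product_integral3//=; [|exact/measurable_EFinP..].
(* The term e(y,w) does not involve [x], so the outer integral is that of a constant over a
   probability. *)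
rewrite [X in fine X - _](_ : _ = ((1 + 4 * a * s ^+ 2) `^ (- (T%:R / 2)))%:E); last first.
  by rewrite gaussian_integral2// integral_cst//= [X in (_ * X)%E](_ : _ = 1%E) ?mule1//;
    exact: probability_setT.
rewrite (gaussian_integral3 T a0 s0)/=.
by congr ((_ * (_ `^ _ - _ `^ _ * _ `^ _))%:E); rewrite /a; field; rewrite gt_eqF.
Qed.

End skew_gaussian_moments.

(** * Averaging over the mixing distribution of the scales *)

Section skew_mixture.
Context {R : realType} {T : nat} {d} {Omega : measurableType d}.
Variables (P : probability Omega R) (sigx ell : {RV P >-> R}).
Hypotheses (hsigx : forall w, 0 < sigx w) (hell : forall w, 0 < ell w).
Context {dS} {S : measurableType dS}.
Variable U : S -> T.-tuple R * T.-tuple R -> R.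
Hypothesis hU : measurable_fun [set: S * (T.-tuple R * T.-tuple R)]
  (fun q => U q.1 q.2).
Variables (u : {RV P >-> S}) (Q : R * R -> probability S R) (su : R).
Hypothesis hUL2 : {ae P, forall w, forall p,
  (fun z => U z p) \in Lfun (Q (sigx w, ell w)) 2%:E}.
Hypothesis hcov : {ae P, forall w, forall p q,
  covariance (Q (sigx w, ell w)) (fun z => U z p) (fun z => U z q)
  = (se_kernel su (ell w) p q)%:E}.
Hypothesis hmean : {ae P, forall w, forall x y,
  ('E_(Q (sigx w, ell w))[fun z => skew_part (U z) x y] = 0)%E}.

Let V w := (sigx w, ell w).
Let gam t := isotropic_gaussian T (t : R * R).1.
Let F w := skew_part (U (u w)).
Let r := roughness sigx ell.
Let pw (c : R) w := (1 + c * r w ^+ 2) `^ (- (T%:R / 2)).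

Let mV : measurable_fun setT V. Proof. exact: measurable_fun_pair. Qed.

Let measurable_pw c : measurable_fun setT (pw c).
Proof.
apply: (measurableT_comp (measurable_powR (- (T%:R / 2)))).
apply: measurable_funD => //; apply: measurable_funM => //.
by apply: measurable_funX; exact: measurable_roughness.
Qed.

Let pw01 c w : 0 <= c -> 0 <= pw c w <= 1.
Proof.
move=> c0; have c1 : 1 <= 1 + c * r w ^+ 2 by rewrite lerDl mulr_ge0// sqr_ge0.
by rewrite /pw powR_ge0/= -[leRHS](powRr0 (1 + c * r w ^+ 2)) ler_powR//.
Qed.

(** The moment for fixed scales is inserted under the integral over Omega, almost everywhere because
    the assumptions on [Q] hold only there. The right side is a real number, which makes F(X,Y)
    square integrable. *)
Lemma integral_skew_sqr_mixture (X Y : {RV P >-> T.-tuple R}) :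
    is_cond_law P V (fun w => (u w, (X w, Y w)))
      (fun t => (Q t \x (gam t \x gam t))%E : probability _ R) ->
  (\int[P]_w (F w (X w) (Y w) ^+ 2)%:E =
   (2 * su ^+ 2 * (1 - fine (\int[P]_w (pw 4 w)%:E)))%:E)%E.
Proof.
move=> hlaw.
have mZ : measurable_fun setT (fun w => (u w, (X w, Y w))).
  by apply: measurable_fun_pair => //; exact: measurable_fun_pair.
have mF2 : measurable_fun setT (fun p : S * (T.-tuple R * T.-tuple R) =>
    (skew_part (U p.1) p.2.1 p.2.2 ^+ 2)%:E).
  apply/measurable_EFinP; apply: measurable_funX.
  by apply: (measurable_skew_part hU) => //; exact: measurableT_comp.
have F20 (p : S * (T.-tuple R * T.-tuple R)) :
    (0 <= (skew_part (U p.1) p.2.1 p.2.2 ^+ 2)%:E)%E.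
  by rewrite lee_fin sqr_ge0.
rewrite (cond_law_integral mV mZ hlaw mF2 F20).
transitivity (\int[P]_w (2 * su ^+ 2 * (cst 1 w - pw 4 w))%:E)%E; last first.
  rewrite integral_scale_sub01//=; last 2 first.
  - by move=> _; rewrite ler01 lexx.
  - by move=> w; exact: pw01.
  rewrite integral_cst//= [X in (_ * X)%E](_ : _ = 1%E) ?mule1//.
  exact: probability_setT.
apply: ae_eq_integral => //.
- exact: (measurable_cond_law_integral mV hlaw).
- apply/measurable_EFinP; apply: measurable_funM => //.
  exact: measurable_funB.
- apply: filterS3 hUL2 hcov hmean => w U2 Uc Um _.
  exact: (integral_skew_sqr (hsigx w) (hell w) hU U2 Uc Um).
Qed.

(** The integrand changes sign, so integrability is assumed here; it will follow from the second
    moments of the two factors. *)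
Lemma integral_skew_shared_mixture (X Y W : {RV P >-> T.-tuple R}) :
    is_cond_law P V (fun w => (u w, (X w, (Y w, W w))))
      (fun t => (Q t \x (gam t \x (gam t \x gam t)))%E : probability _ R) ->
    P.-integrable setT (fun w => (F w (X w) (Y w) * F w (X w) (W w))%:E) ->
  (\int[P]_w (F w (X w) (Y w) * F w (X w) (W w))%:E =
   (2 * su ^+ 2 * (fine (\int[P]_w (pw 2 w)%:E)
     - fine (\int[P]_w (pw 1 w * pw 3 w)%:E)))%:E)%E.
Proof.
move=> hlaw iF.
have mZ : measurable_fun setT (fun w => (u w, (X w, (Y w, W w)))).
  by do 2 apply: measurable_fun_pair => //; exact: measurable_fun_pair.
have mFF : measurable_fun setT (fun p : S * (T.-tuple R * (T.-tuple R * T.-tuple R)) =>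
    (skew_part (U p.1) p.2.1 p.2.2.1 * skew_part (U p.1) p.2.1 p.2.2.2)%:E).
  apply/measurable_EFinP; apply: measurable_funM;
    apply: (measurable_skew_part hU) => //; try exact: measurableT_comp;
    by do 2 apply: measurableT_comp => //.
rewrite (cond_law_integral_signed mV mZ hlaw mFF iF).
rewrite -integral_scale_sub01//; last 3 first.
- exact: measurable_funM.
- by move=> w; exact: pw01.
- move=> w; have /andP[a0 a1] := @pw01 1 w ler01.
  have /andP[b0 b1] := @pw01 3 w (ler0n R 3).
  by rewrite mulr_ge0//= mulr_ile1.
apply: ae_eq_integral => //.
- exact: (measurable_cond_law_integral mV hlaw).
- apply/measurable_EFinP; apply: measurable_funM => //.
  by apply: measurable_funB => //; exact: measurable_funM.
- apply: filterS3 hUL2 hcov hmean => w U2 Uc Um _.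
  rewrite /= (integral_skew_shared (hsigx w) (hell w) hU U2 Uc Um).
  by rewrite /pw mul1r.
Qed.
End skew_mixture.

Theorem mainTheorem8 (R : realType) (T : nat) (hT : (1 <= T)%N)
  (d : measure_display) (Omega : measurableType d) (P : probability Omega R)
  (sigx ell : {RV P >-> R})
  (hsigx : forall w, 0 < sigx w) (hell : forall w, 0 < ell w)
  (* the utility is U (u w), with u a random element of S *)
  (dS : measure_display) (S : measurableType dS)
  (U : S -> T.-tuple R * T.-tuple R -> R)
  (hU : measurable_fun [set: S * (T.-tuple R * T.-tuple R)]
          (fun q => U q.1 q.2))
  (u : {RV P >-> S}) (X Y W : {RV P >-> T.-tuple R})
  (Q : R * R -> probability S R)
  (* conditionally on (sigx, ell): u has law Q (sigx, ell), X, Y, W are i.i.d.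
     N(0, sigx^2 I), and (X, Y, W) is independent of u *)
  (hlaw : is_cond_law P (fun w => (sigx w, ell w))
            (fun w => (u w, (X w, (Y w, W w))))
            (fun t => (Q t \x (isotropic_gaussian T t.1 \x
               (isotropic_gaussian T t.1 \x isotropic_gaussian T t.1)))%E
               : probability _ R))
  (su : R) (hsu : 0 < su)
  (hUL2 : {ae P, forall w, forall p,
     (fun z => U z p) \in Lfun (Q (sigx w, ell w)) 2%:E})
  (hcov : {ae P, forall w, forall p q,
     covariance (Q (sigx w, ell w)) (fun z => U z p) (fun z => U z q)
     = (se_kernel su (ell w) p q)%:E})
  (hmean : {ae P, forall w, forall x y,
     ('E_(Q (sigx w, ell w))[fun z => skew_part (U z) x y] = 0)%E}) :
  let pi_r := distribution P (roughness sigx ell) : probability R R in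
  let E_r (f : R -> R) : R := fine 'E_pi_r[f] in
  shared_endpoint_corr P (fun w => skew_part (U (u w))) sigx ell X Y W
  = (E_r (fun r => (1 + 2 * r ^+ 2) `^ (- (T%:R / 2)))
     - E_r (fun r => (1 + r ^+ 2) `^ (- (T%:R / 2))
                     * (1 + 3 * r ^+ 2) `^ (- (T%:R / 2))))
    / (1 - E_r (fun r => (1 + 4 * r ^+ 2) `^ (- (T%:R / 2)))).
Proof.
move=> pi_r E_r.
pose V w := (sigx w, ell w).
pose gam (t : R * R) := isotropic_gaussian T t.1.
pose F w := skew_part (U (u w)).
pose FXY w := F w (X w) (Y w); pose FXW w := F w (X w) (W w).
pose r := roughness sigx ell.
pose pw (c : R) w := (1 + c * r w ^+ 2) `^ (- (T%:R / 2)).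
have mV : measurable_fun setT V by exact: measurable_fun_pair.
have hlawY : is_cond_law P V (fun w => (u w, (X w, Y w)))
    (fun t => (Q t \x (gam t \x gam t))%E : probability _ R).
  apply: (cond_law_project (h := fst)) hlaw => // t B mB.
  exact: product_prob_fst.
have hlawW : is_cond_law P V (fun w => (u w, (X w, W w)))
    (fun t => (Q t \x (gam t \x gam t))%E : probability _ R).
  apply: (cond_law_project (h := snd)) hlaw => // t B mB.
  exact: product_prob_snd.
have mF (A B : {RV P >-> T.-tuple R}) : measurable_fun setT (fun w => F w (A w) (B w)).
  exact: measurable_skew_part.
have sqrXY := integral_skew_sqr_mixture hsigx hell hU hUL2 hcov hmean hlawY.
have sqrXW := integral_skew_sqr_mixture hsigx hell hU hUL2 hcov hmean hlawW.
have ltyXY : (\int[P]_w (FXY w ^+ 2)%:E < +oo)%E by rewrite sqrXY ltry.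
have ltyXW : (\int[P]_w (FXW w ^+ 2)%:E < +oo)%E by rewrite sqrXW ltry.
have intXY : P.-integrable setT (EFin \o FXY) := sqr_integrable (mF X Y) ltyXY.
have intXW : P.-integrable setT (EFin \o FXW) := sqr_integrable (mF X W) ltyXW.
have intXYXY : P.-integrable setT (EFin \o (FXY \* FXY)) :=
  sqr_integrableM (mF X Y) (mF X Y) ltyXY ltyXY.
have intXYXW : P.-integrable setT (EFin \o (FXY \* FXW)) :=
  sqr_integrableM (mF X Y) (mF X W) ltyXY ltyXW.
have mVu : measurable_fun setT (fun w => (V w, u w)) by exact: measurable_fun_pair.
have mskew : measurable_fun setT (fun p : S * (T.-tuple R * T.-tuple R) =>
    skew_part (U p.1) p.2.1 p.2.2).
  by apply: (measurable_skew_part hU) => //; exact: measurableT_comp.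
rewrite /shared_endpoint_corr /skew_variance /sigma_field_scale.
set C := (X in <<s X >>).
(* Every evaluation of F and both scales are measurable functions of [(V, u)] alone; this places the
   conditioning events where the exchange argument applies. *)
have CVu : C `<=` preimage_set_system setT (fun w => (V w, u w)) measurable.
  rewrite /C !subUset; split; first split.
  - apply: bigcup_sub => p _.
    apply: (@preimage_set_system_comp_sub _ _ _ _ _ _ (fun w => (V w, u w))
      (fun e : (R * R) * S => skew_part (U e.2) p.1 p.2)).
    exact: measurable_skew_part.
  - apply: (@preimage_set_system_comp_sub _ _ _ _ _ _ (fun w => (V w, u w))
      (fun e : (R * R) * S => e.1.1)).
    exact: measurableT_comp.
  - apply: (@preimage_set_system_comp_sub _ _ _ _ _ _ (fun w => (V w, u w))
      (fun e : (R * R) * S => e.1.2)).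
    exact: measurableT_comp.
have mC : C `<=` measurable.
  by move=> A /CVu[B mB <-]; exact: mVu.
have skewN z x y : skew_part (U z) y x = - skew_part (U z) x y.
  by rewrite /skew_part opprB.
have zXY A : <<s C >> A -> (\int[P]_(w in A) (FXY w)%:E = 0)%E.
  move=> /(preimage_generated_sub CVu).
  exact: (integral_skew_eq0 mV _ _ _ hlawY mskew skewN intXY).
have zXW A : <<s C >> A -> (\int[P]_(w in A) (FXW w)%:E = 0)%E.
  move=> /(preimage_generated_sub CVu).
  exact: (integral_skew_eq0 mV _ _ _ hlawW mskew skewN intXW).
have varE : ('E_P[cond_var P <<s C >> FXY] =
    (2 * su ^+ 2 * (1 - fine (\int[P]_w (pw 4 w)%:E)))%:E)%E.
  rewrite /cond_var (expectation_cond_cov mC intXY intXY intXYXY zXY zXY) unlock.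
  exact: sqrXY.
have covE : ('E_P[cond_cov P <<s C >> FXY FXW] =
    (2 * su ^+ 2 * (fine (\int[P]_w (pw 2 w)%:E)
      - fine (\int[P]_w (pw 1 w * pw 3 w)%:E)))%:E)%E.
  rewrite (expectation_cond_cov mC intXY intXW intXYXW zXY zXW) unlock.
  exact: (integral_skew_shared_mixture hsigx hell hU hUL2 hcov hmean hlaw intXYXW).
transitivity ((2 * su ^+ 2 * (1 - fine (\int[P]_w (pw 4 w)%:E)%E))^-1
    * (2 * su ^+ 2 * (fine (\int[P]_w (pw 2 w)%:E)%E
      - fine (\int[P]_w (pw 1 w * pw 3 w)%:E)%E))).
  by congr (_^-1 * _); [exact: (congr1 fine varE)|exact: (congr1 fine covE)].
(* Change of variables turns the averages over [pi_r] into the integrals over Omega found above. *)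
have Er (h : R -> R) : measurable_fun setT h -> (forall x, 0 <= h x) ->
    E_r h = fine (\int[P]_w (h (r w))%:E)%E.
  move=> mh h0; rewrite /E_r unlock ge0_integral_distribution//.
  exact/measurable_EFinP.
have mpow (c : R) : measurable_fun setT (fun x : R => (1 + c * x ^+ 2) `^ (- (T%:R / 2))).
  apply: (measurableT_comp (measurable_powR (- (T%:R / 2)))).
  by apply: measurable_funD => //; apply: measurable_funM => //; exact: measurable_funX.
have pow_ge0 c (x : R) : 0 <= (1 + c * x ^+ 2) `^ (- (T%:R / 2)) by exact: powR_ge0.
have mpow1 : measurable_fun setT (fun x : R => (1 + x ^+ 2) `^ (- (T%:R / 2))).
  by have := mpow 1; under eq_fun do rewrite mul1r.
rewrite !Er//; last 2 first.
- exact: measurable_funM.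
- by move=> x; rewrite mulr_ge0 ?powR_ge0.
rewrite [X in _ = (_ - fine X) / _](eq_integral (fun w => (pw 1 w * pw 3 w)%:E)); last first.
  by move=> w _; rewrite /pw mul1r.
(* The common factor 2 su^2 of variance and covariance cancels because [su] is positive. *)
rewrite invfM mulrACA mulVf ?mul1r; first exact: mulrC.
by rewrite mulf_neq0// sqrf_eq0 gt_eqF.
Qed.
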